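(* Let $n\ge 3$ and reals $s_1,s_2$. For any $a,b\in S_3$ with $a\succ_3 b$ there is a continuous function $p:[0,1]\to S_3$ with $p(0)=b$, $p(1)=a$, and $p(t_1)\succ_3 p(t_0)$ whenever $t_1\ge t_0$.
   Context: $S_3:=\{(x_1,\dots,x_n)\in\mathbb{R}^n : x_1\ge\cdots\ge x_n,\ \sum_{i=1}^n x_i=s_1,\ \sum_{i=1}^n x_i^2=s_2\}$ with the subspace topology from $\mathbb{R}^n$. For $a,b\in\mathbb{R}^n$, $a\succ_3 b$ means $\sum_{i=1}^n f(a_i)\ge\sum_{i=1}^n f(b_i)$ for every three times differentiable $f:\mathbb{R}\to\mathbb{R}$ with $f'''\ge 0$. *)

(* Defs.v *)
(* classical reals. Vectors in R^n are modelled as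
   functions nat -> R, of which only coordinates 0..n-1 matter. *)
From Stdlib Require Import Reals.
Open Scope R_scope.

Fixpoint sumR (n : nat) (g : nat -> R) : R :=
  match n with
  | O => 0
  | S m => sumR m g + g m
  end.

(* membership in S_3 (coordinates x_1..x_n are x 0 .. x (n-1)) *)
Definition inS3 (n : nat) (s1 s2 : R) (x : nat -> R) : Prop :=
  (forall i : nat, (S i < n)%nat -> x (S i) <= x i) /\
  sumR n x = s1 /\
  sumR n (fun i => x i ^ 2) = s2.

Definition thrice_diff_convex3 (f : R -> R) : Prop :=
  exists f1 f2 f3 : R -> R,
    (forall x, derivable_pt_lim f x (f1 x)) /\
    (forall x, derivable_pt_lim f1 x (f2 x)) /\
    (forall x, derivable_pt_lim f2 x (f3 x)) /\
    (forall x, 0 <= f3 x).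

Definition maj3 (n : nat) (a b : nat -> R) : Prop :=
  forall f : R -> R, thrice_diff_convex3 f ->
    sumR n (fun i => f (a i)) >= sumR n (fun i => f (b i)).

Definition unit_interval (t : R) : Prop := 0 <= t <= 1.

(* Main.v *)
(** For vectors with equal first two moments, [maj3 n a b] holds iff
    [sum (t - a_i)_+^2 <= sum (t - b_i)_+^2] for every [t].  If [x] lies strictly below [y] in this
    order, a small elementary move of three coordinates of [x] (outer ones up, middle one down,
    first two moments preserved) gives a point strictly between [x] and [y]: the move is placed
    where the gap between the two sums is positive, starting from the last coordinate in which
    [x] and [y] differ.  A maximal chain between [b] and [a] is closed by compactness and has no
    jumps by density, so the strictly increasing functional [sum x_i^3] maps it bijectively onto
    an interval; the inverse of this map is the path. *)
Require Import Defs.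
From Stdlib Require Import Reals Psatz Classical ClassicalEpsilon.
From Coquelicot Require Import Coquelicot.
From mathcomp Require classical_sets.
Open Scope R_scope.

(** * Finite sums *)

(** The test functions (t - x)_+^2 come from Taylor's formula: modulo a quadratic, f(x) is minus the
    integral of f'''(t) (t - x)_+^2 / 2. Since f''' need not be Riemann integrable, the formula is
    used in differentiated form. The delicate point is density: the gap between the two sums may
    vanish at some levels, while the loss caused by a move must stay under it at every level. The
    moved values C < B <= A are therefore chosen so that the gap is positive on (C, A]; near C,
    where it tends to 0, gap and loss are both compared with (t - C)^2. Cubes detect strictness
    because their third derivative is a positive constant. *)

Lemma sumR_ext n f g : (forall i, (i < n)%nat -> f i = g i) -> sumR n f = sumR n g.
Proof.
  induction n as [|n IH]; intros H; simpl; [reflexivity|].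
  rewrite IH by (intros; apply H; lia). rewrite H by lia. reflexivity.
Qed.

Lemma sumR_le n f g : (forall i, (i < n)%nat -> f i <= g i) -> sumR n f <= sumR n g.
Proof.
  induction n as [|n IH]; intros H; simpl; [lra|].
  apply Rplus_le_compat; [apply IH; intros; apply H; lia | apply H; lia].
Qed.

Lemma sumR_lt n f g k : (forall i, (i < n)%nat -> f i <= g i) ->
  (k < n)%nat -> f k < g k -> sumR n f < sumR n g.
Proof.
  induction n as [|n IH]; intros H Hk Hlt; simpl; [lia|].
  destruct (Nat.eq_dec k n) as [->|Hn].
  - apply Rplus_le_lt_compat; [apply sumR_le; intros; apply H; lia | exact Hlt].
  - apply Rplus_lt_le_compat; [apply IH; [intros; apply H; lia | lia | exact Hlt] | apply H; lia].
Qed.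

Lemma sumR_lin n (c d : R) f g :
  sumR n (fun i => c * f i + d * g i) = c * sumR n f + d * sumR n g.
Proof. induction n as [|n IH]; simpl; [ring|rewrite IH; ring]. Qed.

Lemma sumR_const n c : sumR n (fun _ => c) = INR n * c.
Proof. induction n as [|n IH]; [simpl; ring|]. rewrite S_INR; simpl; rewrite IH; ring. Qed.

Lemma sumR_nonneg n f : (forall i, (i < n)%nat -> 0 <= f i) -> 0 <= sumR n f.
Proof.
  intros H. replace 0 with (sumR n (fun _ => 0)) by (rewrite sumR_const; ring).
  now apply sumR_le.
Qed.

Lemma sumR_term_le n f i :
  (forall j, (j < n)%nat -> 0 <= f j) -> (i < n)%nat -> f i <= sumR n f.
Proof.
  induction n as [|n IH]; intros H Hi; simpl; [lia|].
  assert (0 <= f n) by (apply H; lia).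
  destruct (Nat.eq_dec i n) as [->|Hn].
  - assert (0 <= sumR n f) by (apply sumR_nonneg; intros; apply H; lia). lra.
  - assert (f i <= sumR n f) by (apply IH; [intros; apply H|]; lia). lra.
Qed.

Lemma sumR_derivable n (F F' : nat -> R -> R) t :
  (forall i, (i < n)%nat -> derivable_pt_lim (F i) t (F' i t)) ->
  derivable_pt_lim (fun s => sumR n (fun i => F i s)) t (sumR n (fun i => F' i t)).
Proof.
  induction n as [|n IH]; intros H; simpl.
  - apply derivable_pt_lim_const.
  - apply (derivable_pt_lim_plus (fun s => sumR n (fun i => F i s)) (F n)).
    + apply IH; intros; apply H; lia.
    + apply H; lia.
Qed.

Lemma sumR_cv n (u : nat -> nat -> R) l :
  (forall i, (i < n)%nat -> Un_cv (fun k => u k i) (l i)) ->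
  Un_cv (fun k => sumR n (u k)) (sumR n l).
Proof.
  induction n as [|n IH]; intros H; simpl.
  - intros e He; exists 0%nat; intros; unfold R_dist; rewrite Rminus_diag, Rabs_R0; exact He.
  - apply (CV_plus (fun k => sumR n (u k)) (fun k => u k n)).
    + apply IH; intros; apply H; lia.
    + apply H; lia.
Qed.

Definition upd (x : nat -> R) (i : nat) (v : R) : nat -> R :=
  fun j => if Nat.eq_dec j i then v else x j.

Lemma sumR_upd n g x i v : (i < n)%nat ->
  sumR n (fun j => g (upd x i v j)) = sumR n (fun j => g (x j)) + (g v - g (x i)).
Proof.
  induction n as [|n IH]; intros Hi; simpl; [lia|].
  destruct (Nat.eq_dec i n) as [->|Hn].
  - rewrite (sumR_ext n _ (fun j => g (x j))).
    + unfold upd at 1; destruct (Nat.eq_dec n n); [ring|lia].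
    + intros j Hj; unfold upd; destruct (Nat.eq_dec j n); [lia|reflexivity].
  - rewrite IH by lia. unfold upd at 1; destruct (Nat.eq_dec n i); [lia|ring].
Qed.

(** * Truncated squares and the order *)

Definition pospart (u : R) : R := Rmax u 0.

Lemma pospart_ge0 u : 0 <= pospart u.
Proof. apply Rmax_r. Qed.

Lemma pospart_id u : 0 <= u -> pospart u = u.
Proof. intros; unfold pospart; apply Rmax_left; lra. Qed.

Lemma pospart_0 u : u <= 0 -> pospart u = 0.
Proof. intros; unfold pospart; apply Rmax_right; lra. Qed.

Lemma pospart_mono u v : u <= v -> pospart u <= pospart v.
Proof. intros; unfold pospart, Rmax; destruct (Rle_dec u 0), (Rle_dec v 0); lra. Qed.

Lemma pospart_sq_derivable c t :
  derivable_pt_lim (fun s => pospart (s - c) ^ 2) t (2 * pospart (t - c)).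
Proof.
  (* The error of the linearisation is at most h^2, so [e] itself serves as the radius. *)
  intros e He; exists (mkposreal e He); intros h Hh Hd; simpl in Hd.
  apply Rle_lt_trans with (Rabs h); [|exact Hd].
  replace ((pospart (t + h - c) ^ 2 - pospart (t - c) ^ 2) / h - 2 * pospart (t - c))
    with ((pospart (t + h - c) ^ 2 - pospart (t - c) ^ 2 - 2 * pospart (t - c) * h) / h) by (field; lra).
  unfold Rdiv; rewrite Rabs_mult, Rabs_inv.
  assert (Hp : 0 < Rabs h) by now apply Rabs_pos_lt.
  apply Rmult_le_reg_r with (Rabs h); [exact Hp|].
  rewrite Rmult_assoc, Rinv_l, Rmult_1_r by lra.
  rewrite <- Rabs_mult, (Rabs_pos_eq (h * h)) by nra.
  apply Rabs_le; unfold pospart, Rmax.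
  destruct (Rle_dec (t + h - c) 0), (Rle_dec (t - c) 0); nra.
Qed.

(* The squares of lower truncations [(t - x_i)_+^2] generate the order [maj3] on vectors
   with equal first two moments (lemmas [maj3_below] and [below_maj3]). *)
Definition low (n : nat) (x : nat -> R) (t : R) : R := sumR n (fun i => pospart (t - x i) ^ 2).

Definition below (n : nat) (x y : nat -> R) : Prop := forall t, low n y t <= low n x t.

Lemma below_refl n x : below n x x.
Proof. intros t; lra. Qed.

Lemma below_trans n x y z : below n x y -> below n y z -> below n x z.
Proof. intros H1 H2 t; specialize (H1 t); specialize (H2 t); lra. Qed.

Lemma low_derivable n x t :
  derivable_pt_lim (low n x) t (2 * sumR n (fun i => pospart (t - x i))).
Proof.
  replace (2 * sumR n (fun i => pospart (t - x i)))
    with (sumR n (fun i => 2 * pospart (t - x i))).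
  - apply (sumR_derivable n (fun i s => pospart (s - x i) ^ 2) (fun i s => 2 * pospart (s - x i))).
    intros; apply pospart_sq_derivable.
  - induction n as [|n IH]; simpl; [ring|rewrite IH; ring].
Qed.

Lemma low_ext n x y : (forall i, (i < n)%nat -> x i = y i) -> forall t, low n x t = low n y t.
Proof. intros H t; apply sumR_ext; intros i Hi; rewrite H; auto. Qed.

(** * Taylor expansion about a moving point *)

Lemma derivable_pt_lim_Rmax T d x t :
  derivable_pt_lim T (Rmax t x) d -> (t <= x -> d = 0) ->
  derivable_pt_lim (fun s => T (Rmax s x)) t d.
Proof.
  intros HT H0 e He. destruct (HT e He) as [del Hdel].
  destruct (Rle_lt_dec t x) as [Hx|Hx].
  - rewrite (H0 Hx), (Rmax_right t x) in * by lra.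
    exists del; intros h Hh Hd.
    destruct (Rle_lt_dec (t + h) x) as [Hq|Hq].
    + rewrite (Rmax_right (t + h) x) by lra.
      replace ((T x - T x) / h - 0) with 0 by (field; lra). now rewrite Rabs_R0.
    + rewrite (Rmax_left (t + h) x) by lra.
      (* Only the part k of the step beyond x changes the value; as k <= h, the quotient over h is
         dominated by the one over k. *)
      set (k := t + h - x).
      assert (Hk : 0 < k <= h) by (unfold k; lra).
      rewrite (Rabs_pos_eq h) in Hd by lra.
      specialize (Hdel k ltac:(lra) ltac:(rewrite Rabs_pos_eq; lra)).
      replace (x + k) with (t + h) in Hdel by (unfold k; ring).
      rewrite Rminus_0_r in *.
      apply Rle_lt_trans with (2 := Hdel).
      unfold Rdiv; rewrite !Rabs_mult, !Rabs_inv, (Rabs_pos_eq h), (Rabs_pos_eq k) by lra.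
      apply Rmult_le_compat_l; [apply Rabs_pos|]. apply Rinv_le_contravar; lra.
  - assert (Hm : 0 < Rmin del (t - x)) by (apply Rmin_glb_lt; [apply cond_pos|lra]).
    exists (mkposreal _ Hm); intros h Hh Hd; simpl in Hd.
    pose proof (Rmin_l del (t - x)); pose proof (Rmin_r del (t - x)).
    assert (- (t - x) < h) by (apply Rabs_def2 in Hd; lra).
    rewrite (Rmax_left (t + h) x), (Rmax_left t x) by lra.
    rewrite (Rmax_left t x) in Hdel by lra.
    apply Hdel; [exact Hh|lra].
Qed.

(* Second-order Taylor polynomial of [f] at [s], evaluated at [x]. *)
Definition taylor2 (f f1 f2 : R -> R) (x s : R) : R :=
  f s + f1 s * (x - s) + f2 s * ((x - s) ^ 2 / 2).

(** Differentiating in the expansion point telescopes; only the term with [f3] survives. *)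
Lemma taylor2_derivable f f1 f2 f3 x s :
  derivable_pt_lim f s (f1 s) -> derivable_pt_lim f1 s (f2 s) ->
  derivable_pt_lim f2 s (f3 s) ->
  derivable_pt_lim (taylor2 f f1 f2 x) s (f3 s * ((x - s) ^ 2 / 2)).
Proof.
  intros H H1 H2. apply is_derive_Reals in H, H1, H2. apply is_derive_Reals.
  unfold taylor2. auto_derive.
  - repeat split; eexists; eassumption.
  - apply is_derive_unique in H, H1, H2.
    repeat match goal with |- context [Derive ?g s] =>
      first [replace (Derive g s) with (f1 s) by (symmetry; exact H)
            |replace (Derive g s) with (f2 s) by (symmetry; exact H1)
            |replace (Derive g s) with (f3 s) by (symmetry; exact H2)] end.
    field.
Qed.

(** The derivative of [taylor2] in its expansion point vanishes at x, so freezing that point at x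
    for smaller t leaves no corner. *)
Lemma trunc_taylor2_derivable f f1 f2 f3 x t :
  (forall s, derivable_pt_lim f s (f1 s)) -> (forall s, derivable_pt_lim f1 s (f2 s)) ->
  (forall s, derivable_pt_lim f2 s (f3 s)) ->
  derivable_pt_lim (fun s => taylor2 f f1 f2 x (Rmax s x)) t
    (f3 t * (pospart (t - x) ^ 2 / 2)).
Proof.
  intros H H1 H2.
  replace (f3 t * (pospart (t - x) ^ 2 / 2)) with (f3 (Rmax t x) * ((x - Rmax t x) ^ 2 / 2)).
  - apply derivable_pt_lim_Rmax; [now apply taylor2_derivable|].
    intros Ht; rewrite Rmax_right by lra; field.
  - unfold pospart; destruct (Rle_lt_dec t x).
    + rewrite (Rmax_right t x), (Rmax_right (t - x)) by lra; field.
    + rewrite (Rmax_left t x), (Rmax_left (t - x)) by lra; field.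
Qed.

Lemma finite_bound n (x : nat -> R) : exists M, forall i, (i < n)%nat -> Rabs (x i) <= M.
Proof.
  exists (sumR n (fun i => Rabs (x i))); intros i Hi.
  apply (sumR_term_le n (fun i => Rabs (x i)) i); [intros; apply Rabs_pos|exact Hi].
Qed.

(* Interpolates between [sum f(y_i) - sum f(x_i)] (for [t] far to the left) and, when the first two
   moments of [x] and [y] agree, [0] (for [t] far to the right). *)
Definition trunc_gap n (f f1 f2 : R -> R) (x y : nat -> R) (t : R) : R :=
  sumR n (fun i => taylor2 f f1 f2 (y i) (Rmax t (y i)))
  - sumR n (fun i => taylor2 f f1 f2 (x i) (Rmax t (x i))).

(** Taylor's formula with integral remainder, differentiated: the sign of the derivative gives
    monotonicity by the mean value theorem, and [f3] is never integrated. *)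
Lemma trunc_gap_derivable n f f1 f2 f3 x y t :
  (forall s, derivable_pt_lim f s (f1 s)) -> (forall s, derivable_pt_lim f1 s (f2 s)) ->
  (forall s, derivable_pt_lim f2 s (f3 s)) ->
  derivable_pt_lim (trunc_gap n f f1 f2 x y) t (f3 t * ((low n y t - low n x t) / 2)).
Proof.
  intros H H1 H2.
  assert (E : forall z, derivable_pt_lim
     (fun t => sumR n (fun i => taylor2 f f1 f2 (z i) (Rmax t (z i)))) t (f3 t * (low n z t / 2))).
  { intros z. replace (f3 t * (low n z t / 2))
      with (sumR n (fun i => f3 t * (pospart (t - z i) ^ 2 / 2))).
    - apply (sumR_derivable n (fun i t => taylor2 f f1 f2 (z i) (Rmax t (z i)))
        (fun i t => f3 t * (pospart (t - z i) ^ 2 / 2))).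
      intros; now apply trunc_taylor2_derivable.
    - unfold low; clear; induction n as [|n IH]; cbn [sumR]; [field|rewrite IH; field]. }
  replace (f3 t * ((low n y t - low n x t) / 2))
    with (f3 t * (low n y t / 2) - f3 t * (low n x t / 2)) by field.
  exact (derivable_pt_lim_minus _ _ _ _ _ (E y) (E x)).
Qed.

Definition same_moments n x y : Prop :=
  sumR n x = sumR n y /\ sumR n (fun i => x i ^ 2) = sumR n (fun i => y i ^ 2).

Lemma inS3_same_moments n s1 s2 x y : inS3 n s1 s2 x -> inS3 n s1 s2 y -> same_moments n x y.
Proof. intros (_ & A & B) (_ & C & D); split; congruence. Qed.

Lemma sumR_quadratic n (x : nat -> R) c0 c1 c2 :
  sumR n (fun i => c0 + c1 * x i + c2 * x i ^ 2)
  = INR n * c0 + c1 * sumR n x + c2 * sumR n (fun i => x i ^ 2).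
Proof.
  induction n as [|n IH]; [simpl; ring|]. rewrite S_INR.
  cbn [sumR]. rewrite IH. ring.
Qed.

(** To the right of all coordinates every expansion is taken at the same point t, and a quadratic
    sees only the first two moments. *)
Lemma trunc_gap_right n f f1 f2 x y M t : same_moments n x y ->
  (forall i, (i < n)%nat -> Rabs (x i) <= M) -> (forall i, (i < n)%nat -> Rabs (y i) <= M) ->
  M <= t -> trunc_gap n f f1 f2 x y t = 0.
Proof.
  intros [E1 E2] Hx Hy Ht.
  assert (E : forall z, (forall i, (i < n)%nat -> Rabs (z i) <= M) ->
    sumR n (fun i => taylor2 f f1 f2 (z i) (Rmax t (z i))) =
    INR n * (f t - f1 t * t + f2 t * t ^ 2 / 2) + (f1 t - f2 t * t) * sumR n z
     + (f2 t / 2) * sumR n (fun i => z i ^ 2)).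
  { intros z Hz. rewrite <- sumR_quadratic. apply sumR_ext; intros i Hi.
    specialize (Hz i Hi); apply Rabs_le_between in Hz.
    rewrite Rmax_left by lra. unfold taylor2; field. }
  unfold trunc_gap; rewrite (E y Hy), (E x Hx), E1, E2; ring.
Qed.

Lemma trunc_gap_left n f f1 f2 x y M t :
  (forall i, (i < n)%nat -> Rabs (x i) <= M) -> (forall i, (i < n)%nat -> Rabs (y i) <= M) ->
  t <= - M -> trunc_gap n f f1 f2 x y t = sumR n (fun i => f (y i)) - sumR n (fun i => f (x i)).
Proof.
  intros Hx Hy Ht.
  assert (E : forall z, (forall i, (i < n)%nat -> Rabs (z i) <= M) ->
    sumR n (fun i => taylor2 f f1 f2 (z i) (Rmax t (z i))) = sumR n (fun i => f (z i))).
  { intros z Hz. apply sumR_ext; intros i Hi.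
    specialize (Hz i Hi); apply Rabs_le_between in Hz.
    rewrite Rmax_right by lra. unfold taylor2; field. }
  unfold trunc_gap; rewrite (E y Hy), (E x Hx); ring.
Qed.

Lemma derivable_nonpos_decreasing (F F' : R -> R) a b :
  (forall t, derivable_pt_lim F t (F' t)) -> (forall t, F' t <= 0) -> a <= b -> F b <= F a.
Proof.
  intros H Hn [Hab| ->]; [|lra].
  destruct (MVT_cor2 F F' a b Hab) as (c & Hc & _); [intros; apply H|].
  specialize (Hn c); nra.
Qed.

Lemma trunc_gap_decreasing n f f1 f2 f3 x y a b :
  (forall s, derivable_pt_lim f s (f1 s)) -> (forall s, derivable_pt_lim f1 s (f2 s)) ->
  (forall s, derivable_pt_lim f2 s (f3 s)) -> (forall s, 0 <= f3 s) ->
  below n x y -> a <= b -> trunc_gap n f f1 f2 x y b <= trunc_gap n f f1 f2 x y a.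
Proof.
  intros H H1 H2 H3 Hb.
  apply (derivable_nonpos_decreasing _ (fun t => f3 t * ((low n y t - low n x t) / 2))).
  - intros; now apply trunc_gap_derivable.
  - intros t; specialize (H3 t); specialize (Hb t). nra.
Qed.

Lemma below_maj3 n x y : same_moments n x y -> below n x y -> maj3 n y x.
Proof.
  intros Hm Hb f (f1 & f2 & f3 & H & H1 & H2 & H3).
  destruct (finite_bound n x) as [M1 HM1], (finite_bound n y) as [M2 HM2].
  (* The 0 guarantees - M <= M. *)
  set (M := Rmax 0 (Rmax M1 M2)).
  assert (HM : 0 <= M /\ M1 <= M /\ M2 <= M).
  { unfold M; pose proof (Rmax_l 0 (Rmax M1 M2)); pose proof (Rmax_r 0 (Rmax M1 M2));
    pose proof (Rmax_l M1 M2); pose proof (Rmax_r M1 M2); lra. }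
  assert (Hx : forall i, (i < n)%nat -> Rabs (x i) <= M) by (intros i Hi; specialize (HM1 i Hi); lra).
  assert (Hy : forall i, (i < n)%nat -> Rabs (y i) <= M) by (intros i Hi; specialize (HM2 i Hi); lra).
  pose proof (trunc_gap_decreasing n f f1 f2 f3 x y (- M) M H H1 H2 H3 Hb ltac:(lra)) as D.
  rewrite (trunc_gap_left n f f1 f2 x y M (- M)), (trunc_gap_right n f f1 f2 x y M M) in D
    by (assumption || lra). lra.
Qed.

(** * The sum of cubes as a strictly monotone functional *)

Definition cubes n (x : nat -> R) : R := sumR n (fun i => x i ^ 3).

Lemma cube_thrice_diff_convex3 :
  (forall s, derivable_pt_lim (fun x => x ^ 3) s (3 * s ^ 2)) /\
  (forall s, derivable_pt_lim (fun x => 3 * x ^ 2) s (6 * s)) /\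
  (forall s, derivable_pt_lim (fun x => 6 * x) s 6).
Proof.
  repeat split; intros s; apply is_derive_Reals; auto_derive; auto; ring.
Qed.

Lemma below_cubes_le n x y : same_moments n x y -> below n x y -> cubes n x <= cubes n y.
Proof.
  intros Hm Hb. destruct cube_thrice_diff_convex3 as (D1 & D2 & D3).
  apply Rge_le, (below_maj3 n x y Hm Hb (fun x => x ^ 3)).
  exists (fun s => 3 * s ^ 2), (fun s => 6 * s), (fun _ => 6).
  repeat split; auto; intros; lra.
Qed.

(* The gap function of the cube is then constant, and its derivative is [3 * (low n y - low n x)]. *)
Lemma below_cubes_eq n x y :
  same_moments n x y -> below n x y -> cubes n x = cubes n y -> forall t, low n x t = low n y t.
Proof.
  intros Hm Hb He t. destruct cube_thrice_diff_convex3 as (D1 & D2 & D3).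
  destruct (finite_bound n x) as [M1 HM1], (finite_bound n y) as [M2 HM2].
  (* The margin 1 keeps t + h inside [- M, M] for |h| < 1, where [G] will vanish. *)
  set (M := Rmax (Rabs t + 1) (Rmax M1 M2)).
  assert (HM : Rabs t + 1 <= M /\ M1 <= M /\ M2 <= M).
  { unfold M; pose proof (Rmax_l (Rabs t + 1) (Rmax M1 M2));
    pose proof (Rmax_r (Rabs t + 1) (Rmax M1 M2));
    pose proof (Rmax_l M1 M2); pose proof (Rmax_r M1 M2); lra. }
  assert (Hx : forall i, (i < n)%nat -> Rabs (x i) <= M) by (intros i Hi; specialize (HM1 i Hi); lra).
  assert (Hy : forall i, (i < n)%nat -> Rabs (y i) <= M) by (intros i Hi; specialize (HM2 i Hi); lra).
  set (G := trunc_gap n (fun x => x ^ 3) (fun s => 3 * s ^ 2) (fun s => 6 * s) x y).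
  assert (HG : forall a b, a <= b -> G b <= G a).
  { intros a b; apply (trunc_gap_decreasing n _ _ _ (fun _ => 6)); auto; intros; lra. }
  assert (HL : G (- M) = 0).
  { unfold G; rewrite (trunc_gap_left _ _ _ _ _ _ M) by (assumption || lra).
    unfold cubes in He; lra. }
  assert (HR : G M = 0).
  { unfold G; apply (trunc_gap_right _ _ _ _ _ _ M); (assumption || lra). }
  assert (HD : derivable_pt_lim G t (6 * ((low n y t - low n x t) / 2))).
  { apply (trunc_gap_derivable n _ _ _ (fun _ => 6)); auto. }
  assert (H0 : derivable_pt_lim G t 0).
  { intros e Hep; exists (mkposreal 1 Rlt_0_1); intros h Hh Hd; simpl in Hd.
    pose proof (Rabs_le_between t (Rabs t)) as [Ht _]. specialize (Ht ltac:(lra)).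
    apply Rabs_def2 in Hd.
    assert (forall s, - M <= s <= M -> G s = 0) as HZ.
    { intros s Hs. pose proof (HG (- M) s ltac:(lra)). pose proof (HG s M ltac:(lra)). lra. }
    rewrite (HZ (t + h)), (HZ t) by lra.
    replace ((0 - 0) / h - 0) with 0 by (field; lra). now rewrite Rabs_R0. }
  pose proof (uniqueness_limite _ _ _ _ HD H0). lra.
Qed.

(** * Sorted vectors *)

Definition nonincreasing n (x : nat -> R) : Prop := forall i, (S i < n)%nat -> x (S i) <= x i.

Lemma sorted_le n x i j : nonincreasing n x -> (i <= j)%nat -> (j < n)%nat -> x j <= x i.
Proof.
  intros H Hij; induction Hij as [|j Hij IH]; intros Hj; [lra|].
  specialize (IH ltac:(lia)). specialize (H j Hj). lra.
Qed.

Lemma greatest_index (P : nat -> Prop) n :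
  (exists i, (i < n)%nat /\ P i) ->
  exists k, (k < n)%nat /\ P k /\ forall i, (k < i < n)%nat -> ~ P i.
Proof.
  induction n as [|n IH]; intros (i & Hi & HP); [lia|].
  destruct (classic (P n)) as [Hn|Hn].
  - exists n; repeat split; [lia|exact Hn|intros; lia].
  - destruct IH as (k & Hk & HPk & Hmax).
    + exists i; split; [|exact HP]. assert (i <> n) by (intros ->; tauto). lia.
    + exists k; repeat split; [lia|exact HPk|]. intros j Hj.
      destruct (Nat.eq_dec j n) as [->|]; [exact Hn|apply Hmax; lia].
Qed.

(* The last index of disagreement has [x_k < y_k]: only the last coordinates contribute to
   [low] at a level between [x_k] and [y_k]. *)
Lemma below_last_disagreement n x y k :
  nonincreasing n x -> nonincreasing n y -> below n x y -> (k < n)%nat -> x k <> y k ->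
  (forall i, (k < i < n)%nat -> x i = y i) -> x k < y k.
Proof.
  intros Sx Sy Hb Hk Hne Heq.
  destruct (Rlt_le_dec (x k) (y k)) as [|Hle]; [assumption|exfalso].
  specialize (Hb (x k)); apply Rle_not_lt in Hb; apply Hb; clear Hb.
  apply (sumR_lt n _ _ k); [|exact Hk|].
  - intros i Hi. destruct (Compare_dec.le_lt_dec i k) as [Hik|Hik].
    + rewrite (pospart_0 (x k - x i)) by (pose proof (sorted_le n x i k Sx Hik Hk); lra).
      pose proof (pow2_ge_0 (pospart (x k - y i))). lra.
    + rewrite (Heq i) by lia. lra.
  - rewrite (pospart_0 (x k - x k)), (pospart_id (x k - y k)) by lra. simpl.
    assert (0 < x k - y k) by lra. nra.
Qed.

(** Each vector is below the other, so at the last disagreement the strict inequality would hold in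
    both directions. *)
Lemma low_eq_coord n x y : nonincreasing n x -> nonincreasing n y ->
  (forall t, low n x t = low n y t) -> forall i, (i < n)%nat -> x i = y i.
Proof.
  intros Sx Sy H i Hi. apply NNPP; intros Hne.
  destruct (greatest_index (fun i => x i <> y i) n) as (k & Hk & Hnk & Hmax);
    [exists i; auto|].
  assert (Heq : forall j, (k < j < n)%nat -> x j = y j)
    by (intros j Hj; apply NNPP, Hmax, Hj).
  assert (x k < y k) by (apply (below_last_disagreement n); auto; intros t; rewrite H; lra).
  assert (y k < x k).
  { apply (below_last_disagreement n); auto; [intros t; rewrite H; lra|].
    intros; symmetry; auto. }
  lra.
Qed.

(** * Smooth approximation of the truncated squares *)

(* A smoothing of [x |-> - (t - x)_+^2]; its third derivative is
   [3 e^2 / (2 ((x - t)^2 + e)^(5/2))]. *)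
Definition smooth_low (e t x : R) : R := ((x - t) * sqrt ((x - t) ^ 2 + e) - (x - t) ^ 2) / 2.

Lemma smooth_low_convex3 e t : 0 < e -> thrice_diff_convex3 (smooth_low e t).
Proof.
  intros He.
  assert (Hp : forall x, 0 < (x - t) ^ 2 + e)
    by (intros x; pose proof (pow2_ge_0 (x - t)); lra).
  assert (Hs : forall x, 0 < sqrt ((x - t) ^ 2 + e)) by (intros x; apply sqrt_lt_R0, Hp).
  assert (Hq : forall x, sqrt ((x - t) ^ 2 + e) ^ 2 = (x - t) ^ 2 + e)
    by (intros x; apply pow2_sqrt, Rlt_le, Hp).
  exists (fun x => ((2 * (x - t) ^ 2 + e) / sqrt ((x - t) ^ 2 + e) - 2 * (x - t)) / 2),
    (fun x => ((x - t) * (2 * (x - t) ^ 2 + 3 * e) / sqrt ((x - t) ^ 2 + e) ^ 3 - 2) / 2),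
    (fun x => 3 * e ^ 2 / (2 * sqrt ((x - t) ^ 2 + e) ^ 5)).
  repeat split; intros x; specialize (Hp x); specialize (Hs x); specialize (Hq x).
  - apply is_derive_Reals; unfold smooth_low; auto_derive; [simpl in *; lra|].
    change ((x + - t) * ((x + - t) * 1)) with ((x - t) ^ 2).
    set (q := sqrt ((x - t) ^ 2 + e)) in *.
    (* Eliminating [e] through q^2 turns the goal into an identity of rational functions. *)
    replace e with (q ^ 2 - (x - t) ^ 2) by lra. field; lra.
  - apply is_derive_Reals; auto_derive.
    { change ((x + - t) * ((x + - t) * 1)) with ((x - t) ^ 2).
      repeat split; [lra|apply Rgt_not_eq; lra]. }
    change ((x + - t) * ((x + - t) * 1)) with ((x - t) ^ 2).
    set (q := sqrt ((x - t) ^ 2 + e)) in *.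
    replace e with (q ^ 2 - (x - t) ^ 2) by lra. field; lra.
  - apply is_derive_Reals; auto_derive.
    { change ((x + - t) * ((x + - t) * 1)) with ((x - t) ^ 2).
      repeat split; [lra|]. apply Rgt_not_eq. simpl. apply Rmult_lt_0_compat; [exact Hs|].
      apply Rmult_lt_0_compat; [exact Hs|]. rewrite Rmult_1_r; exact Hs. }
    change ((x + - t) * ((x + - t) * 1)) with ((x - t) ^ 2).
    set (q := sqrt ((x - t) ^ 2 + e)) in *.
    replace e with (q ^ 2 - (x - t) ^ 2) by lra. field; lra.
  - apply Rdiv_le_0_compat; [nra|]. pose proof (pow_lt _ 5 Hs); lra.
Qed.

(** With u = x - t and q = sqrt(u^2 + e), the error is |u| (q - |u|) / 2 up to sign, and q - |u| = e
    / (q + |u|). *)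
Lemma smooth_low_close e t x : 0 < e -> Rabs (smooth_low e t x + pospart (t - x) ^ 2) <= e.
Proof.
  intros He. unfold smooth_low.
  set (u := x - t). assert (Hp : 0 <= u ^ 2 + e) by nra.
  pose proof (sqrt_pos (u ^ 2 + e)) as Hs. pose proof (pow2_sqrt _ Hp) as Hq.
  set (q := sqrt (u ^ 2 + e)) in *.
  apply Rabs_le; destruct (Rle_lt_dec 0 u).
  - rewrite pospart_0 by (unfold u in *; lra).
    assert (u <= q) by nra. assert (u * (q - u) <= e) by nra. nra.
  - rewrite pospart_id by (unfold u in *; lra). replace (t - x) with (- u) by (unfold u; ring).
    assert (- u <= q) by nra. assert (- u * (q + u) <= e) by nra. nra.
Qed.

Lemma maj3_below n a b : maj3 n a b -> below n b a.
Proof.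
  intros Hm t. apply le_epsilon; intros e He.
  (* Each of the two sums costs at most n d; the + 1 avoids dividing by zero when n = 0. *)
  set (d := e / (2 * (INR n + 1))).
  pose proof (pos_INR n) as Hn.
  assert (Hd : 0 < d) by (apply Rdiv_lt_0_compat; lra).
  assert (Hde : 2 * INR n * d <= e).
  { assert (e = 2 * INR n * d + 2 * d) by (unfold d; field; lra). lra. }
  clearbody d.
  specialize (Hm _ (smooth_low_convex3 d t Hd)).
  assert (B : forall z, Rabs (sumR n (fun i => smooth_low d t (z i)) + low n z t) <= INR n * d).
  { intros z. unfold low. clear - Hd. induction n as [|n IH]; cbn [sumR].
    - simpl; rewrite Rplus_0_l, Rabs_R0; lra.
    - rewrite S_INR. pose proof (smooth_low_close d t (z n) Hd) as H.
      apply Rabs_le_between in IH, H. apply Rabs_le; lra. }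
  pose proof (B a) as Ba; pose proof (B b) as Bb.
  apply Rabs_le_between in Ba, Bb. lra.
Qed.

(** * Density of the order *)

Lemma least_index (P : nat -> Prop) k :
  P k -> exists m, (m <= k)%nat /\ P m /\ forall i, (i < m)%nat -> ~ P i.
Proof.
  revert P; induction k as [k IH] using (well_founded_induction Wf_nat.lt_wf); intros P HP.
  destruct (classic (exists i, (i < k)%nat /\ P i)) as [(i & Hi & HPi)|Hn].
  - destruct (IH i Hi P HPi) as (m & Hm & Hr). exists m; split; [lia|exact Hr].
  - exists k; repeat split; [lia|exact HP|]. intros i Hi HPi; apply Hn; exists i; auto.
Qed.

Lemma low_right n x y M t : same_moments n x y ->
  (forall i, (i < n)%nat -> Rabs (x i) <= M) -> (forall i, (i < n)%nat -> Rabs (y i) <= M) ->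
  M <= t -> low n x t = low n y t.
Proof.
  intros [E1 E2] Hx Hy Ht.
  assert (E : forall z, (forall i, (i < n)%nat -> Rabs (z i) <= M) ->
    low n z t = INR n * t ^ 2 + (- 2 * t) * sumR n z + 1 * sumR n (fun i => z i ^ 2)).
  { intros z Hz. rewrite <- sumR_quadratic. apply sumR_ext; intros i Hi.
    specialize (Hz i Hi); apply Rabs_le_between in Hz. rewrite pospart_id by lra. ring. }
  rewrite (E x Hx), (E y Hy), E1, E2. reflexivity.
Qed.

(* At a zero [t] of the nonnegative gap [low n x - low n y] its derivative vanishes too: the sums
   of the first and second powers of [X_i = (t - x_i)_+] and
   [Y_i = (t - y_i)_+] agree, so [sum (Y_i - X_i) (Y_i + X_i - c) = 0] for every [c]. *)
Lemma below_touching n x y t c :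
  below n x y -> low n x t = low n y t ->
  sumR n (fun i => (pospart (t - y i) - pospart (t - x i)) * (pospart (t - y i) + pospart (t - x i) - c)) = 0.
Proof.
  intros Hb He.
  assert (HD : derivable_pt_lim (fun s => low n x s - low n y s) t
     (2 * sumR n (fun i => pospart (t - x i)) - 2 * sumR n (fun i => pospart (t - y i)))).
  { apply (derivable_pt_lim_minus (low n x) (low n y)); apply low_derivable. }
  pose proof (deriv_minimum (fun s => low n x s - low n y s) (t - 1) (t + 1) t
    (exist _ _ HD) ltac:(lra) ltac:(lra)) as H0.
  simpl in H0.
  assert (H1 : sumR n (fun i => pospart (t - x i)) = sumR n (fun i => pospart (t - y i))).
  { assert (2 * sumR n (fun i => pospart (t - x i)) - 2 * sumR n (fun i => pospart (t - y i)) = 0); [|lra].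
    apply H0. intros s _ _. specialize (Hb s). lra. }
  unfold low in He.
  rewrite (sumR_ext n _ (fun i =>
    1 * (1 * pospart (t - y i) ^ 2 + (-1) * pospart (t - x i) ^ 2)
    + (- c) * (1 * pospart (t - y i) + (-1) * pospart (t - x i)))) by (intros; ring).
  rewrite !sumR_lin, He, H1. ring.
Qed.

(** Indices k0..k form the block where x takes the value x_k. If the gap vanished at t, apply
    [below_touching] with c = Y_j + X_j for j = k0 - 1 (c = 0 if k0 = 0). Then term j is zero. On
    the block Y_i < X_i and Y_i + X_i > c, so the terms are negative. Before j one has X_i = 0 and
    Y_i <= Y_j <= c, so the terms are nonpositive; after k they vanish. The sum would be negative.
    The [pred] leaves x_j itself unconstrained by t. *)
Lemma low_gap_pos n x y k k0 t :
  nonincreasing n x -> nonincreasing n y -> below n x y ->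
  (k < n)%nat -> x k < y k -> (forall i, (k < i < n)%nat -> x i = y i) ->
  (k0 <= k)%nat -> x k0 = x k -> (forall i, (i < k0)%nat -> x k < x i) ->
  x k < t -> (forall i, (i < pred k0)%nat -> t <= x i) ->
  low n y t < low n x t.
Proof.
  intros Sx Sy Hb Hk Hxy Htail Hk0 Ek0 Hhead Ht Hfree.
  destruct (Rlt_le_dec (low n y t) (low n x t)) as [|Hle]; [assumption|exfalso].
  assert (He : low n x t = low n y t) by (specialize (Hb t); lra).
  set (c := match k0 with O => 0 | S j => pospart (t - y j) + pospart (t - x j) end).
  pose proof (below_touching n x y t c Hb He) as H0.
  assert (Hneg : forall i, (k0 <= i <= k)%nat ->
    (pospart (t - y i) - pospart (t - x i)) * (pospart (t - y i) + pospart (t - x i) - c) < 0).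
  { intros i Hi.
    pose proof (sorted_le n x i k Sx ltac:(lia) Hk).
    pose proof (sorted_le n x k0 i Sx ltac:(lia) ltac:(lia)).
    pose proof (sorted_le n y i k Sy ltac:(lia) Hk).
    assert (x i = x k) as -> by lra.
    rewrite (pospart_id (t - x k)) by lra.
    assert (pospart (t - y i) < t - x k) by (unfold pospart; apply Rmax_lub_lt; lra).
    assert (c < pospart (t - y i) + (t - x k)).
    { unfold c; destruct k0 as [|j].
      - pose proof (pospart_ge0 (t - y i)); lra.
      - pose proof (sorted_le n y j i Sy ltac:(lia) ltac:(lia)).
        pose proof (pospart_mono (t - y j) (t - y i) ltac:(lra)).
        specialize (Hhead j ltac:(lia)).
        assert (pospart (t - x j) < t - x k) by (unfold pospart; apply Rmax_lub_lt; lra). lra. }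
    nra. }
  assert (Hlt : sumR n (fun i =>
      (pospart (t - y i) - pospart (t - x i)) * (pospart (t - y i) + pospart (t - x i) - c))
     < sumR n (fun _ => 0)).
  { apply (sumR_lt n _ _ k); [|exact Hk|apply Hneg; lia].
    intros i Hi. destruct (Compare_dec.le_lt_dec i k) as [Hik|Hik].
    2: { rewrite (Htail i) by lia. lra. }
    destruct (Compare_dec.le_lt_dec k0 i) as [Hki|Hki]; [apply Rlt_le, Hneg; lia|].
    unfold c; destruct k0 as [|j]; [lia|]; simpl in Hfree.
    destruct (Nat.eq_dec i j) as [->|Hij]; [lra|].
    rewrite (pospart_0 (t - x i)) by (specialize (Hfree i ltac:(lia)); lra).
    pose proof (sorted_le n y i j Sy ltac:(lia) ltac:(lia)).
    pose proof (pospart_mono (t - y i) (t - y j) ltac:(lra)).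
    pose proof (pospart_ge0 (t - y i)). pose proof (pospart_ge0 (t - x j)). nra. }
  rewrite sumR_const in Hlt. lra.
Qed.

(** Up to level y_k the first k + 1 coordinates of y contribute nothing and those after k cancel.
    This quadratic lower bound controls the gap near x_k, where it has no positive margin. *)
Lemma low_gap_left n x y k t :
  nonincreasing n x -> nonincreasing n y -> (k < n)%nat -> (forall i, (k < i < n)%nat -> x i = y i) ->
  x k <= t <= y k -> (t - x k) ^ 2 <= low n x t - low n y t.
Proof.
  intros Sx Sy Hk Htail Ht.
  replace (low n x t - low n y t) with
    (sumR n (fun i => 1 * pospart (t - x i) ^ 2 + (-1) * pospart (t - y i) ^ 2))
    by (rewrite sumR_lin; unfold low; ring).
  assert (Hy : forall i, (i <= k)%nat -> pospart (t - y i) = 0).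
  { intros i Hi; apply pospart_0. pose proof (sorted_le n y i k Sy Hi Hk); lra. }
  apply Rle_trans with (1 * pospart (t - x k) ^ 2 + (-1) * pospart (t - y k) ^ 2).
  - rewrite (Hy k), (pospart_id (t - x k)) by (lia || lra). simpl; lra.
  - apply (sumR_term_le n (fun i => 1 * pospart (t - x i) ^ 2 + (-1) * pospart (t - y i) ^ 2) k);
      [|exact Hk].
    intros i Hi. destruct (Compare_dec.le_lt_dec i k) as [Hik|Hik].
    + rewrite (Hy i Hik). pose proof (pow2_ge_0 (pospart (t - x i))). lra.
    + rewrite (Htail i) by lia. lra.
Qed.

(* [sigma] is the ratio of the upward shifts of the outer points; it solves the quadratic
   constraint for the size [alpha] of the shift rationally. *)
Lemma three_point_shift A B C eta : C < B -> B <= A -> 0 < eta ->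
  exists al ga, 0 < al /\ 0 < ga /\ al + ga < eta /\
    (A + al) ^ 2 + (B - (al + ga)) ^ 2 + (C + ga) ^ 2 = A ^ 2 + B ^ 2 + C ^ 2.
Proof.
  intros HBC HAB He.
  set (w := B - C). assert (Hw : 0 < w) by (unfold w; lra).
  (* With ga = sig * al, the squares are preserved exactly when al (1 + sig + sig^2) = w sig - (A -
     B); this [e] makes the right side eta / 2. *)
  set (e := eta / (2 * w)).
  assert (Hep : 0 < e) by (apply Rdiv_lt_0_compat; lra).
  assert (Hew : w * e = eta / 2) by (unfold e; field; lra).
  set (sig := (A - B) / w + e).
  assert (Hab : 0 <= (A - B) / w) by (apply Rdiv_le_0_compat; lra).
  assert (Hsig : 0 < sig) by (unfold sig; lra).
  assert (Hsw : w * sig = A - B + eta / 2) by (unfold sig; rewrite Rmult_plus_distr_l, Hew; field; lra).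
  set (q := 1 + sig + sig ^ 2). assert (Hq : 0 < q) by (unfold q; nra).
  assert (Hal : eta / 2 / q * q = eta / 2) by (field; lra).
  assert (Hpos : 0 < eta / 2 / q) by (apply Rdiv_lt_0_compat; lra).
  exists (eta / 2 / q), (sig * (eta / 2 / q)).
  set (al := eta / 2 / q) in *.
  repeat split; [lra|nra|unfold q in Hal; nra|].
  replace (C) with (B - w) by (unfold w; ring).
  replace A with (B + w * sig - eta / 2) by lra.
  rewrite <- Hal. unfold q. ring.
Qed.

(** * Effect of a three-point move on [low] *)

Lemma pospart_sq_mono u v : u <= v -> pospart u ^ 2 <= pospart v ^ 2.
Proof. intros H; apply pospart_mono in H. pose proof (pospart_ge0 u). apply pow_incr; lra. Qed.

Definition low3 A B C t : R := pospart (t - A) ^ 2 + pospart (t - B) ^ 2 + pospart (t - C) ^ 2.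

Section ThreePoint.
Variables A B C al ga : R.
Hypotheses (HAB : B <= A) (Hal : 0 < al) (Hga : 0 < ga) (Hgap : C + ga <= B - (al + ga)).
Hypothesis Hsq : (A + al) ^ 2 + (B - (al + ga)) ^ 2 + (C + ga) ^ 2 = A ^ 2 + B ^ 2 + C ^ 2.

(** The loss of [low] at level t caused by the move. *)
Let E t := low3 A B C t - low3 (A + al) (B - (al + ga)) (C + ga) t.

Lemma three_point_left t : t <= C -> E t = 0.
Proof. intros; unfold E, low3; rewrite !pospart_0 by lra; ring. Qed.

Lemma three_point_right t : A + al <= t -> E t = 0.
Proof. intros; unfold E, low3; rewrite !pospart_id by lra; nra. Qed.

Lemma three_point_nonneg t : 0 <= E t.
Proof.
  unfold E, low3.
  destruct (Rle_lt_dec t (B - (al + ga))) as [H1|H1].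
  - rewrite (pospart_0 (t - A)), (pospart_0 (t - B)), (pospart_0 (t - (A + al))),
      (pospart_0 (t - (B - (al + ga)))) by lra.
    pose proof (pospart_sq_mono (t - (C + ga)) (t - C) ltac:(lra)). lra.
  - rewrite (pospart_id (t - C)), (pospart_id (t - (C + ga))),
      (pospart_id (t - (B - (al + ga)))) by lra.
    destruct (Rle_lt_dec t B) as [H2|H2].
    + rewrite (pospart_0 (t - A)), (pospart_0 (t - B)), (pospart_0 (t - (A + al))) by lra.
      (* concave in [t] on [B - al - ga, B], hence bounded below by its values at the endpoints *)
      assert (v1 : 0 <= al ^ 2 + 2 * al * (A - B) + 2 * al * (al + ga) - (al + ga) ^ 2).
      { replace (al ^ 2 + 2 * al * (A - B) + 2 * al * (al + ga) - (al + ga) ^ 2)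
          with (ga * (2 * (B - (al + ga) - C) - ga)) by lra.
        apply Rmult_le_pos; lra. }
      assert (v0 : 0 <= al * (A - B)) by (apply Rmult_le_pos; lra).
      (* Conservation of both moments turns [E t] into this quadratic on the middle interval. *)
      assert (H : 0 <= al ^ 2 + 2 * al * (A - t) - (B - t) ^ 2); [|lra].
      apply Rmult_le_reg_l with (al + ga); [lra|].
      (* The chord between the two endpoint values, plus the excess of the concave quadratic over
         it. *)
      replace ((al + ga) * (al ^ 2 + 2 * al * (A - t) - (B - t) ^ 2)) with
        ((al + ga - (B - t)) * (al ^ 2 + 2 * (al * (A - B)))
         + (B - t) * (al ^ 2 + 2 * al * (A - B) + 2 * al * (al + ga) - (al + ga) ^ 2)
         + (al + ga) * ((B - t) * (al + ga - (B - t)))) by ring.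
      assert (0 <= (al + ga - (B - t)) * (al ^ 2 + 2 * (al * (A - B))))
        by (apply Rmult_le_pos; [lra|pose proof (pow2_ge_0 al); lra]).
      assert (0 <= (B - t) * (al ^ 2 + 2 * al * (A - B) + 2 * al * (al + ga) - (al + ga) ^ 2))
        by (apply Rmult_le_pos; [lra|exact v1]).
      assert (0 <= (al + ga) * ((B - t) * (al + ga - (B - t))))
        by (repeat apply Rmult_le_pos; lra).
      lra.
    + rewrite (pospart_id (t - B)) by lra.
      (* Past B, conservation of both moments gives E t = (A + al - t)_+^2 - (A - t)_+^2, whose sign
         is [Hs]. *)
      pose proof Hsq. assert (Hs : 0 <= (t - (A + al)) ^ 2 - pospart (t - (A + al)) ^ 2
                    - ((t - A) ^ 2 - pospart (t - A) ^ 2)).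
      { destruct (Rle_lt_dec t A).
        - rewrite !pospart_0 by lra. nra.
        - rewrite (pospart_id (t - A)) by lra.
          destruct (Rle_lt_dec t (A + al)); [rewrite pospart_0 by lra|rewrite pospart_id by lra]; nra. }
      nra.
Qed.

(** The value is al^2. Level A is where the strictness of the move will be tested. *)
Lemma three_point_at_top : 0 < E A.
Proof.
  unfold E, low3.
  rewrite (pospart_0 (A - A)), (pospart_0 (A - (A + al))), !pospart_id by lra. nra.
Qed.

(** Lowering B can only increase [low], so the loss is at most what C contributed. Counterpart of
    [low_gap_left]. *)
Lemma three_point_near t : C <= t <= A -> E t <= (t - C) ^ 2.
Proof.
  intros Ht; unfold E, low3.
  rewrite (pospart_0 (t - A)), (pospart_0 (t - (A + al))), (pospart_id (t - C)) by lra.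
  pose proof (pospart_sq_mono (t - B) (t - (B - (al + ga))) ltac:(lra)).
  pose proof (pow2_ge_0 (pospart (t - (C + ga)))). lra.
Qed.

Lemma pospart_sq_shift u d M : 0 <= d -> pospart u <= M -> pospart u ^ 2 - pospart (u - d) ^ 2 <= 2 * M * d.
Proof.
  intros Hd HM.
  assert (pospart u <= pospart (u - d) + d) by (unfold pospart, Rmax; destruct (Rle_dec u 0), (Rle_dec (u - d) 0); lra).
  pose proof (pospart_mono (u - d) u ltac:(lra)). pose proof (pospart_ge0 (u - d)).
  replace (pospart u ^ 2 - pospart (u - d) ^ 2) with ((pospart u + pospart (u - d)) * (pospart u - pospart (u - d))) by ring.
  apply Rle_trans with ((2 * M) * (pospart u - pospart (u - d))).
  - apply Rmult_le_compat_r; lra.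
  - apply Rmult_le_compat_l; lra.
Qed.

(** Only the raised points A and C lose, each at a Lipschitz rate; hence a small move fits under any
    uniform positive margin. *)
Lemma three_point_small t : t <= A + 1 -> C <= A -> E t <= 2 * (A - C + 1) * (al + ga).
Proof.
  intros Ht HC; unfold E, low3.
  pose proof (pospart_sq_mono (t - B) (t - (B - (al + ga))) ltac:(lra)).
  assert (HA : pospart (t - A) <= A - C + 1) by (unfold pospart; apply Rmax_lub; lra).
  assert (HCt : pospart (t - C) <= A - C + 1) by (unfold pospart; apply Rmax_lub; lra).
  pose proof (pospart_sq_shift (t - A) al _ ltac:(lra) HA).
  pose proof (pospart_sq_shift (t - C) ga _ ltac:(lra) HCt).
  replace (t - (A + al)) with (t - A - al) by ring.
  replace (t - (C + ga)) with (t - C - ga) by ring. lra.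
Qed.
End ThreePoint.

Lemma low_continuous n x t : continuity_pt (low n x) t.
Proof. apply derivable_continuous_pt. eexists; apply low_derivable. Qed.

Definition shift3 (x : nat -> R) (i j k : nat) (al ga : R) : nat -> R :=
  upd (upd (upd x i (x i + al)) j (x j - (al + ga))) k (x k + ga).

Lemma sumR_shift3 n g x i j k al ga : (i < j < k)%nat -> (k < n)%nat ->
  sumR n (fun m => g (shift3 x i j k al ga m)) =
  sumR n (fun m => g (x m)) + (g (x i + al) + g (x j - (al + ga)) + g (x k + ga))
  - (g (x i) + g (x j) + g (x k)).
Proof.
  intros Hij Hk; unfold shift3. rewrite !sumR_upd by lia.
  unfold upd at 1 2 3.
  repeat match goal with |- context [Nat.eq_dec ?a ?b] => destruct (Nat.eq_dec a b); try lia end.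
  ring.
Qed.

(** Only two comparisons tighten: between j and [S j], and between i and its predecessor. All others
    widen. *)
Lemma shift3_sorted n x i j al ga : nonincreasing n x -> (i < j)%nat -> (S j < n)%nat ->
  0 < al -> 0 < ga -> x (S j) + ga <= x j - (al + ga) ->
  (forall m, i = S m -> x i + al <= x m) ->
  nonincreasing n (shift3 x i j (S j) al ga).
Proof.
  intros Sx Hij Hj Hal Hga Hgap Htop m Hm. pose proof (Sx m Hm).
  unfold shift3, upd.
  repeat match goal with |- context [Nat.eq_dec ?a ?b] => destruct (Nat.eq_dec a b); try lia end;
  subst; try lra.
  apply Htop; reflexivity.
Qed.

(** C is the value of x at the last disagreement, B the value just before its block, A the value one
    index before that. C and A are raised at the first index of their blocks, and B is lowered at
    the last index of its own, so that sortedness can survive. *)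
Theorem below_dense n s1 s2 x y :
  inS3 n s1 s2 x -> inS3 n s1 s2 y -> below n x y -> ~ below n y x ->
  exists z, inS3 n s1 s2 z /\ below n x z /\ below n z y /\ ~ below n z x /\ ~ below n y z.
Proof.
  intros Ix Iy Hb Hnb.
  pose proof (inS3_same_moments _ _ _ _ _ Ix Iy) as Hmom.
  destruct Ix as (Sx & Ex1 & Ex2), Iy as (Sy & Ey1 & Ey2).
  fold (nonincreasing n x) in Sx. fold (nonincreasing n y) in Sy.
  destruct (greatest_index (fun i => x i <> y i) n) as (k & Hk & Hnk & Hmax).
  { apply NNPP; intros Hall; apply Hnb; intros t. apply Req_le, low_ext.
    intros i Hi; apply NNPP; intros Hne; apply Hall; eauto. }
  assert (Htail : forall i, (k < i < n)%nat -> x i = y i)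
    by (intros i Hi; apply NNPP, Hmax, Hi).
  pose proof (below_last_disagreement n x y k Sx Sy Hb Hk Hnk Htail) as Hxy.
  destruct (least_index (fun i => x i = x k) k eq_refl) as (k0 & Hk0 & Ek0 & Hleast).
  assert (Hhead : forall i, (i < k0)%nat -> x k < x i).
  { intros i Hi. pose proof (sorted_le n x i k Sx ltac:(lia) Hk).
    specialize (Hleast i Hi). lra. }
  pose proof (fun t => low_gap_pos n x y k k0 t Sx Sy Hb Hk Hxy Htail Hk0 Ek0 Hhead) as Hgap.
  (* With fewer than two indices before the block, [Hgap] would hold at every level above x_k, but
     the gap vanishes beyond all coordinates. *)
  destruct k0 as [|[|i1]].
  1, 2: exfalso;
    destruct (finite_bound n x) as [M1 HM1], (finite_bound n y) as [M2 HM2];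
    pose proof (Rmax_l M1 M2); pose proof (Rmax_r M1 M2);
    set (M := Rmax M1 M2) in *;
    pose proof (HM1 k Hk) as HMk; apply Rabs_le_between in HMk;
    specialize (Hgap (M + 1) ltac:(lra) ltac:(simpl; intros; lia));
    rewrite (low_right n x y M (M + 1) Hmom) in Hgap;
      [lra|intros i Hi; specialize (HM1 i Hi); lra|intros i Hi; specialize (HM2 i Hi); lra|lra].
  set (j := S i1) in *. simpl in Hgap.
  destruct (least_index (fun i => x i = x i1) i1 eq_refl) as (i0 & Hi0 & Ei0 & Hi0least).
  assert (HCB : x (S j) < x j) by (rewrite Ek0; apply Hhead; lia).
  assert (HBA : x j <= x i0) by (apply (sorted_le n); auto; unfold j; lia).
  set (D := fun t => low n x t - low n y t).
  assert (HD : forall t, x (S j) < t <= x i0 -> 0 < D t).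
  { intros t Ht. unfold D. assert (low n y t < low n x t); [|lra]. apply Hgap; [lra|].
    intros i Hi.
    pose proof (sorted_le n x i i1 Sx ltac:(unfold j in *; lia) ltac:(unfold j in *; lia)). lra. }
  assert (HDc : forall t, continuity_pt D t)
    by (intros t; apply (continuity_pt_minus (low n x) (low n y)); apply low_continuous).
  (* Up to C + r both quadratic estimates, [low_gap_left] and [three_point_near], apply. *)
  set (r := Rmin (y k - x k) (x i0 - x (S j))).
  assert (Hr : 0 < r <= y k - x k /\ r <= x i0 - x (S j)).
  { unfold r; repeat split; [apply Rmin_glb_lt; lra|apply Rmin_l|apply Rmin_r]. }
  destruct (continuity_ab_min D (x (S j) + r) (x i0)) as (mx & Hmin & Hmx);
    [lra|intros; apply HDc|].
  assert (Hd : 0 < D mx) by (apply HD; lra).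
  (* The loss extends up to A + al, so half of the margin is carried beyond A by continuity. *)
  destruct (HDc (x i0) (D mx / 2)) as (e1 & He1 & Hcont); [lra|].
  assert (HDA : forall t, x i0 <= t -> t < x i0 + e1 -> D mx / 2 < D t).
  { intros t Ht1 Ht2. pose proof (Hmin (x i0) ltac:(lra)).
    destruct (Req_dec t (x i0)) as [->|Hne]; [lra|].
    specialize (Hcont t). simpl in Hcont. unfold R_dist in Hcont.
    assert (Hq : Rabs (D t - D (x i0)) < D mx / 2).
    { apply Hcont. repeat split; [congruence|]. apply Rabs_def1; lra. }
    apply Rabs_def2 in Hq. lra. }
  assert (Htop : exists g, 0 < g /\ forall m, i0 = S m -> x i0 + g <= x m).
  { destruct i0 as [|m]; [exists 1; split; [lra|intros; lia]|].
    exists (x m - x (S m)). pose proof (Sx m ltac:(unfold j in *; lia)).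
    specialize (Hi0least m ltac:(lia)). split; [lra|]. intros m' Em; injection Em as <-; lra. }
  destruct Htop as (g & Hg & Htop).
  set (A := x i0) in *. set (B := x j) in *. set (C := x (S j)) in *.
  set (q := D mx / (4 * (A - C + 1))).
  assert (Hq : 0 < q /\ 2 * (A - C + 1) * q = D mx / 2).
  { unfold q; split; [apply Rdiv_lt_0_compat; lra|field; lra]. }
  (* In order: [three_point_small] reaches A + al, the margin lasts that far, the lowered B stays
     above the raised C, A stays under its predecessor, and the loss is below D mx / 2. *)
  set (eta := Rmin (Rmin 1 e1) (Rmin ((B - C) / 2) (Rmin g q))).
  assert (Heta : 0 < eta /\ eta <= 1 /\ eta <= e1 /\ eta <= (B - C) / 2 /\ eta <= g /\ eta <= q).
  { unfold eta.
    pose proof (Rmin_l (Rmin 1 e1) (Rmin ((B - C) / 2) (Rmin g q))).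
    pose proof (Rmin_r (Rmin 1 e1) (Rmin ((B - C) / 2) (Rmin g q))).
    pose proof (Rmin_l 1 e1). pose proof (Rmin_r 1 e1).
    pose proof (Rmin_l ((B - C) / 2) (Rmin g q)). pose proof (Rmin_r ((B - C) / 2) (Rmin g q)).
    pose proof (Rmin_l g q). pose proof (Rmin_r g q).
    repeat split; try lra. repeat apply Rmin_glb_lt; lra. }
  destruct Heta as (Heta & Hn1 & Hn2 & Hn3 & Hn4 & Hn5).
  destruct (three_point_shift A B C eta HCB HBA Heta) as (al & ga & Hal & Hga & Hag & Hsq).
  assert (Hgap' : C + ga <= B - (al + ga)) by lra.
  assert (Hidx : (i0 < j < S j)%nat /\ (S j < n)%nat) by (unfold j in *; lia).
  destruct Hidx as [Hidx Hjn].
  set (z := shift3 x i0 j (S j) al ga).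
  set (E := fun t => low3 A B C t - low3 (A + al) (B - (al + ga)) (C + ga) t).
  assert (HE : forall t, low n z t = low n x t - E t).
  { intros t. unfold low, z. rewrite (sumR_shift3 n (fun v => pospart (t - v) ^ 2)) by assumption.
    unfold E, low3. fold A B C. ring. }
  assert (HEsmall : forall t, t <= A + 1 -> E t < D mx / 2).
  { intros t Ht. apply Rle_lt_trans with (2 * (A - C + 1) * (al + ga)).
    - apply three_point_small; assumption || lra.
    - rewrite <- (proj2 Hq). apply Rmult_lt_compat_l; lra. }
  assert (HE0 : forall t, 0 <= E t) by (intros; apply three_point_nonneg; assumption).
  assert (HEA : 0 < E A) by (apply three_point_at_top; assumption).
  exists z. repeat split.
  - apply shift3_sorted; auto; try lia. intros m Hm. fold A. specialize (Htop m Hm). lra.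
  - unfold z. rewrite (sumR_shift3 n (fun v => v)) by assumption. fold A B C.
    change (sumR n (fun m => x m)) with (sumR n x). lra.
  - unfold z. rewrite (sumR_shift3 n (fun v => v ^ 2)) by assumption. fold A B C. cbv beta. lra.
  - intros t. rewrite HE. specialize (HE0 t). lra.
  (* Loss and gap are separated by (t - C)^2 up to C + r and by D mx / 2 from there to A + al;
     elsewhere the loss is zero. *)
  - intros t. rewrite HE. enough (E t <= D t) by (unfold D in *; lra).
    destruct (Rle_lt_dec t C) as [H1|H1].
    { assert (E t = 0) as -> by (apply three_point_left; assumption || lra).
      specialize (Hb t). unfold D; lra. }
    destruct (Rle_lt_dec t (C + r)) as [H2|H2].
    { apply Rle_trans with ((t - C) ^ 2); [apply three_point_near; assumption || lra|].
      rewrite Ek0. apply low_gap_left; auto. lra. }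
    destruct (Rle_lt_dec t A) as [H3|H3].
    { specialize (HEsmall t ltac:(lra)). specialize (Hmin t ltac:(lra)). lra. }
    destruct (Rle_lt_dec t (A + al)) as [H4|H4].
    { specialize (HEsmall t ltac:(lra)). specialize (HDA t ltac:(lra) ltac:(lra)). lra. }
    assert (E t = 0) as -> by (apply three_point_right; assumption || lra).
    specialize (Hb t). unfold D; lra.
  - intros H. specialize (H A). rewrite HE in H. lra.
  - intros H. specialize (H A). rewrite HE in H.
    specialize (HEsmall A ltac:(lra)). specialize (HDA A ltac:(lra) ltac:(lra)).
    unfold D in *. lra.
Qed.

(** * Maximal chains and compactness *)

(** Hausdorff's maximality principle, from Zorn's lemma for chains ordered by inclusion: adjoining a
    comparable w cannot enlarge the chain. *)
Lemma maximal_chain (T : Type) (le : T -> T -> Prop) (I : T -> Prop) :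
  (forall x, le x x) ->
  exists C : T -> Prop,
    (forall x, C x -> I x) /\
    (forall x y, C x -> C y -> le x y \/ le y x) /\
    (forall w, I w -> (forall c, C c -> le c w \/ le w c) -> C w).
Proof.
  intros Hrefl.
  set (P := fun C : T -> Prop =>
    (forall x, C x -> I x) /\ (forall x y, C x -> C y -> le x y \/ le y x)).
  destruct (@classical_sets.Zorn_bigcup T P) as (C & [HI HC] & Hmax).
  - intros F HF Htot; split.
    + intros x [X HX Hx]. exact (proj1 (HF X HX) x Hx).
    + intros x y [X HX Hx] [Y HY Hy].
      destruct (Htot X Y HX HY) as [H|H].
      * exact (proj2 (HF Y HY) x y (H x Hx) Hy).
      * exact (proj2 (HF X HX) x y Hx (H y Hy)).
  - exists C; repeat split; [exact HI|exact HC|].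
    intros w Hw Hcomp. apply NNPP; intros Hn.
    apply (Hmax (fun x => C x \/ x = w)).
    + split; [intros x Hx; left; exact Hx|].
      intros H; apply Hn, (H w). right; reflexivity.
    + split.
      * intros x [Hx| ->]; [apply HI, Hx|exact Hw].
      * intros x y [Hx| ->] [Hy| ->]; [apply HC; assumption|apply Hcomp, Hx| |left; apply Hrefl].
        destruct (Hcomp y Hy); auto.
Qed.

(** * Sequential compactness *)

Definition extraction (sg : nat -> nat) : Prop := forall k, (sg k < sg (S k))%nat.

Lemma extraction_ge sg k : extraction sg -> (k <= sg k)%nat.
Proof. intros H; induction k as [|k IH]; [lia|]. specialize (H k). lia. Qed.

Lemma extraction_mono sg i j : extraction sg -> (i < j)%nat -> (sg i < sg j)%nat.
Proof.
  intros H Hij; induction Hij as [|j Hij IH]; [apply H|]. specialize (H j). lia.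
Qed.

Lemma extraction_comp sg ta : extraction sg -> extraction ta -> extraction (fun k => sg (ta k)).
Proof. intros Hs Ht k; apply extraction_mono; [exact Hs|apply Ht]. Qed.

Lemma Un_cv_extraction u l sg : extraction sg -> Un_cv u l -> Un_cv (fun k => u (sg k)) l.
Proof.
  intros Hs Hu e He. destruct (Hu e He) as [N HN]. exists N; intros k Hk.
  apply HN. pose proof (extraction_ge sg k Hs). lia.
Qed.

Lemma inv_INR_lt e : 0 < e -> exists N, forall k, (N <= k)%nat -> 0 < / INR (S k) < e.
Proof.
  intros He. destruct (archimed_cor1 e He) as (N & HN & HN0).
  exists N; intros k Hk. assert (0 < INR N) by (apply lt_0_INR; lia).
  assert (INR N <= INR (S k)) by (apply le_INR; lia).
  split; [apply Rinv_0_lt_compat; lra|].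
  apply Rle_lt_trans with (2 := HN). apply Rinv_le_contravar; lra.
Qed.

(** Bolzano-Weierstrass yields a cluster point; the subsequence is built by choosing, past the
    previous index, a term within 1 / (k + 1) of it. *)
Lemma bounded_cv_extraction (u : nat -> R) M : (forall k, Rabs (u k) <= M) ->
  exists sg l, extraction sg /\ Un_cv (fun k => u (sg k)) l.
Proof.
  intros HM.
  destruct (Bolzano_Weierstrass u (fun c => - M <= c <= M)) as [l Hl].
  { apply compact_P3. }
  { intros k; apply Rabs_le_between, HM. }
  assert (Hc : forall q : nat * nat, exists p, (fst q <= p)%nat /\ Rabs (u p - l) < / INR (S (snd q))).
  { intros [N k]; simpl fst; simpl snd.
    assert (Hp : 0 < / INR (S k)) by (apply Rinv_0_lt_compat, lt_0_INR; lia).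
    destruct (Hl (fun y => Rabs (y - l) < / INR (S k)) N) as (p & Hp1 & Hp2).
    - exists (mkposreal _ Hp). intros y Hy; exact Hy.
    - exists p; split; assumption. }
  set (ch := fun q => proj1_sig (constructive_indefinite_description _ (Hc q))).
  assert (Hch : forall q, (fst q <= ch q)%nat /\ Rabs (u (ch q) - l) < / INR (S (snd q)))
    by (intros q; unfold ch; apply proj2_sig).
  set (sg := fix sg k := match k with O => ch (O, O) | S k' => ch (S (sg k'), S k') end).
  exists sg, l; split.
  - intros k. change (sg (S k)) with (ch (S (sg k), S k)).
    destruct (Hch (S (sg k), S k)) as [H _]; simpl in H; lia.
  - intros e He. destruct (inv_INR_lt e He) as [N HN]. exists N; intros k Hk.
    apply Rlt_trans with (/ INR (S k)); [|apply HN; lia].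
    destruct k as [|k]; [apply (Hch (O, O))|apply (Hch (S (sg k), S k))].
Qed.

Definition vec_cv n (u : nat -> nat -> R) (l : nat -> R) : Prop :=
  forall i, (i < n)%nat -> Un_cv (fun k => u k i) (l i).

Lemma vec_cv_extraction n u l sg : extraction sg -> vec_cv n u l -> vec_cv n (fun k => u (sg k)) l.
Proof. intros Hs Hu i Hi; apply (Un_cv_extraction (fun k => u k i)); auto. Qed.

Lemma vec_bounded_cv_extraction n (u : nat -> nat -> R) M :
  (forall k i, (i < n)%nat -> Rabs (u k i) <= M) ->
  exists sg l, extraction sg /\ vec_cv n (fun k => u (sg k)) l.
Proof.
  induction n as [|n IH]; intros HM.
  - exists (fun k => k), (fun _ => 0). split; [intros k; lia|intros i Hi; lia].
  - destruct IH as (sg & l & Hs & Hl); [intros; apply HM; lia|].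
    destruct (bounded_cv_extraction (fun k => u (sg k) n) M) as (ta & ln & Ht & Hln);
      [intros; apply HM; lia|].
    exists (fun k => sg (ta k)), (upd l n ln). split; [apply extraction_comp; assumption|].
    intros i Hi. unfold upd. destruct (Nat.eq_dec i n) as [->|Hne]; [exact Hln|].
    apply (Un_cv_extraction (fun k => u (sg k) i)); [exact Ht|apply Hl; lia].
Qed.

Lemma Un_cv_const c : Un_cv (fun _ => c) c.
Proof.
  intros e He; exists 0%nat; intros; unfold R_dist. rewrite Rminus_diag, Rabs_R0; exact He.
Qed.

Lemma Un_cv_eventually_le u v l m N :
  Un_cv u l -> Un_cv v m -> (forall k, (N <= k)%nat -> u k <= v k) -> l <= m.
Proof.
  intros Hu Hv H. apply (@Rle_cv_lim (fun k => u (k + N)%nat) (fun k => v (k + N)%nat)).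
  - intros k; apply H; lia.
  - apply CV_shift', Hu.
  - apply CV_shift', Hv.
Qed.

Lemma sumR_comp_cv n (g : R -> R) u l : (forall r, continuity_pt g r) -> vec_cv n u l ->
  Un_cv (fun k => sumR n (fun i => g (u k i))) (sumR n (fun i => g (l i))).
Proof.
  intros Hg Hu. apply (sumR_cv n (fun k i => g (u k i)) (fun i => g (l i))).
  intros i Hi. apply (continuity_seq g (fun k => u k i)); auto.
Qed.

Lemma low_cv n u l t : vec_cv n u l -> Un_cv (fun k => low n (u k) t) (low n l t).
Proof.
  apply (sumR_comp_cv n (fun r => pospart (t - r) ^ 2)). intros r.
  apply (continuity_pt_comp (fun r => t - r) (fun v => pospart v ^ 2)).
  - apply derivable_continuous_pt. eexists. apply is_derive_Reals. auto_derive; [exact I|reflexivity].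
  - apply derivable_continuous_pt. exists (2 * pospart (t - r - 0)).
    pose proof (pospart_sq_derivable 0 (t - r)) as H.
    intros e He; destruct (H e He) as [d Hd]; exists d; intros h Hh Hhd.
    specialize (Hd h Hh Hhd). rewrite !Rminus_0_r in *. exact Hd.
Qed.

Lemma pow_continuous m r : continuity_pt (fun x => x ^ m) r.
Proof. apply derivable_continuous_pt, derivable_pt_pow. Qed.

Lemma cubes_cv n u l : vec_cv n u l -> Un_cv (fun k => cubes n (u k)) (cubes n l).
Proof. apply (sumR_comp_cv n (fun r => r ^ 3)). intros; apply pow_continuous. Qed.

Lemma inS3_cv n s1 s2 u l : (forall k, inS3 n s1 s2 (u k)) -> vec_cv n u l -> inS3 n s1 s2 l.
Proof.
  intros Hu Hl. split; [|split].
  - intros i Hi. apply (Un_cv_eventually_le (fun k => u k (S i)) (fun k => u k i) _ _ 0).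
    + apply Hl, Hi.
    + apply Hl; lia.
    + intros k _; apply Hu, Hi.
  - apply (UL_sequence (fun k => sumR n (u k))); [apply sumR_cv, Hl|].
    intros e He; exists 0%nat; intros k _. rewrite (proj1 (proj2 (Hu k))).
    unfold Rdist; rewrite Rminus_diag, Rabs_R0; exact He.
  - apply (UL_sequence (fun k => sumR n (fun i => u k i ^ 2))).
    + apply (sumR_comp_cv n (fun r => r ^ 2)); [intros; apply pow_continuous|exact Hl].
    + intros e He; exists 0%nat; intros k _. rewrite (proj2 (proj2 (Hu k))).
      unfold Rdist; rewrite Rminus_diag, Rabs_R0; exact He.
Qed.

Lemma inS3_bounded n s1 s2 x i : inS3 n s1 s2 x -> (i < n)%nat -> Rabs (x i) <= s2 + 1.
Proof.
  intros (_ & _ & H) Hi.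
  assert (x i ^ 2 <= s2).
  { rewrite <- H. apply (sumR_term_le n (fun i => x i ^ 2) i); [intros; apply pow2_ge_0|exact Hi]. }
  (* Uses |v| <= v^2 + 1, which avoids a square root in the bound. *)
  apply Rabs_le; nra.
Qed.

Lemma inS3_compact n s1 s2 u : (forall k, inS3 n s1 s2 (u k)) ->
  exists sg l, extraction sg /\ vec_cv n (fun k => u (sg k)) l /\ inS3 n s1 s2 l.
Proof.
  intros Hu.
  destruct (vec_bounded_cv_extraction n u (s2 + 1)) as (sg & l & Hs & Hl).
  { intros k i Hi; apply (inS3_bounded n s1 s2); auto. }
  exists sg, l; repeat split; try assumption;
    apply (inS3_cv n s1 s2 (fun k => u (sg k)) l); auto.
Qed.

Lemma below_cubes_eq_below n s1 s2 x y : inS3 n s1 s2 x -> inS3 n s1 s2 y ->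
  below n x y -> cubes n y <= cubes n x -> below n y x.
Proof.
  intros Ix Iy Hb Hc t.
  pose proof (inS3_same_moments _ _ _ _ _ Ix Iy) as Hm.
  pose proof (below_cubes_le n x y Hm Hb).
  rewrite (below_cubes_eq n x y Hm Hb ltac:(lra)). lra.
Qed.

Lemma below_cubes_eq_coord n s1 s2 x y i : inS3 n s1 s2 x -> inS3 n s1 s2 y ->
  below n x y -> cubes n y <= cubes n x -> (i < n)%nat -> x i = y i.
Proof.
  intros Ix Iy Hb Hc. pose proof (below_cubes_eq_below _ _ _ _ _ Ix Iy Hb Hc) as Hb'.
  apply low_eq_coord; [exact (proj1 Ix)|exact (proj1 Iy)|].
  intros t; specialize (Hb t); specialize (Hb' t); lra.
Qed.

(** This makes the inverse of [cubes] on a chain continuous. Counterexamples for d = 1 / (k + 1)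
    would subconverge to comparable points with equal cubes, hence equal coordinates, yet at
    distance at least e in coordinate i. *)
Lemma cubes_modulus n s1 s2 i e : (i < n)%nat -> 0 < e ->
  exists d, 0 < d /\ forall x y, inS3 n s1 s2 x -> inS3 n s1 s2 y -> below n x y ->
    cubes n y - cubes n x < d -> Rabs (x i - y i) < e.
Proof.
  intros Hi He. apply NNPP; intros Hn.
  assert (Hc : forall k : nat, exists q : (nat -> R) * (nat -> R),
    inS3 n s1 s2 (fst q) /\ inS3 n s1 s2 (snd q) /\ below n (fst q) (snd q) /\
    cubes n (snd q) - cubes n (fst q) < / INR (S k) /\ e <= Rabs (fst q i - snd q i)).
  { intros k. apply NNPP; intros Hk. apply Hn. exists (/ INR (S k)).
    split; [apply Rinv_0_lt_compat, lt_0_INR; lia|].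
    intros x y Ix Iy Hb Hd. destruct (Rlt_le_dec (Rabs (x i - y i)) e) as [|Hle]; [assumption|].
    exfalso; apply Hk. exists (x, y). repeat split; simpl; try assumption; try apply Ix; apply Iy. }
  set (u := fun k => fst (proj1_sig (constructive_indefinite_description _ (Hc k)))).
  set (v := fun k => snd (proj1_sig (constructive_indefinite_description _ (Hc k)))).
  assert (Huv : forall k, inS3 n s1 s2 (u k) /\ inS3 n s1 s2 (v k) /\ below n (u k) (v k) /\
    cubes n (v k) - cubes n (u k) < / INR (S k) /\ e <= Rabs (u k i - v k i))
    by (intros k; unfold u, v; apply proj2_sig).
  destruct (inS3_compact n s1 s2 u) as (sg & x & Hs & Hx & Ix); [apply Huv|].
  destruct (inS3_compact n s1 s2 (fun k => v (sg k))) as (ta & y & Ht & Hy & Iy);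
    [intros; apply Huv|].
  apply (vec_cv_extraction n _ x ta Ht) in Hx. cbv beta in Hx.
  pose proof (extraction_comp sg ta Hs Ht) as Hst.
  set (rh := fun k => sg (ta k)) in *.
  change (vec_cv n (fun k => u (rh k)) x) in Hx. change (vec_cv n (fun k => v (rh k)) y) in Hy.
  assert (Hb : below n x y).
  { intros t. apply (Un_cv_eventually_le (fun k => low n (v (rh k)) t) (fun k => low n (u (rh k)) t) _ _ 0);
      [apply (low_cv n (fun k => v (rh k))), Hy|apply (low_cv n (fun k => u (rh k))), Hx|].
    intros k _; apply Huv. }
  assert (Hcub : cubes n y - cubes n x <= 0).
  { apply le_epsilon; intros d Hd. destruct (inv_INR_lt d Hd) as [N HN].
    apply (Un_cv_eventually_le (fun k => cubes n (v (rh k)) - cubes n (u (rh k))) (fun _ => 0 + d) _ _ N).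
    - apply (CV_minus (fun k => cubes n (v (rh k))) (fun k => cubes n (u (rh k))));
        [apply (cubes_cv n (fun k => v (rh k))), Hy|apply (cubes_cv n (fun k => u (rh k))), Hx].
    - apply Un_cv_const.
    - intros k Hk. pose proof (extraction_ge rh k Hst) as Hge. destruct (Huv (rh k)) as (_ & _ & _ & H & _).
      specialize (HN (rh k) ltac:(lia)). lra. }
  assert (Hxy : x i = y i) by (apply (below_cubes_eq_coord n s1 s2); auto; lra).
  destruct (Hx i Hi (e / 2) ltac:(lra)) as [N1 HN1]. destruct (Hy i Hi (e / 2) ltac:(lra)) as [N2 HN2].
  specialize (HN1 (N1 + N2)%nat ltac:(lia)). specialize (HN2 (N1 + N2)%nat ltac:(lia)).
  destruct (Huv (rh (N1 + N2)%nat)) as (_ & _ & _ & _ & H).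
  unfold Rdist in *. apply Rabs_def2 in HN1, HN2.
  apply Rle_not_lt in H; apply H. apply Rabs_def1; lra.
Qed.

(** * Values of [cubes] on a maximal chain *)

Definition limit_closed (E : R -> Prop) : Prop :=
  forall L, (forall e, 0 < e -> exists r, E r /\ Rabs (r - L) < e) -> E L.

Lemma limit_closed_greatest E s : limit_closed E -> (exists r, E r /\ r <= s) ->
  exists m, E m /\ m <= s /\ forall r, E r -> r <= s -> r <= m.
Proof.
  intros HE (r0 & Hr0 & Hr0s).
  destruct (completeness (fun r => E r /\ r <= s)) as [m [Hub Hlub]].
  - exists s; intros r [_ H]; exact H.
  - exists r0; auto.
  - exists m. split; [|split; [apply Hlub; intros r [_ H]; exact H|intros r H1 H2; apply Hub; auto]].
    apply HE. intros e He. apply NNPP; intros Hn.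
    assert (m <= m - e); [|lra]. apply Hlub. intros r [Hr Hrs].
    destruct (Rle_lt_dec r (m - e)) as [|Hlt]; [assumption|].
    exfalso; apply Hn. exists r; split; [exact Hr|].
    pose proof (Hub r (conj Hr Hrs)). apply Rabs_def1; lra.
Qed.

Lemma limit_closed_least E s : limit_closed E -> (exists r, E r /\ s <= r) ->
  exists m, E m /\ s <= m /\ forall r, E r -> s <= r -> m <= r.
Proof.
  intros HE (r0 & Hr0 & Hr0s).
  destruct (limit_closed_greatest (fun r => E (- r)) (- s)) as (m & Hm & Hms & Hmax).
  - intros L HL. apply HE. intros e He. destruct (HL e He) as (r & Hr & Hre).
    exists (- r); split; [exact Hr|]. replace (- r - - L) with (- (r - L)) by ring.
    rewrite Rabs_Ropp; exact Hre.
  - exists (- r0); rewrite Ropp_involutive; split; [exact Hr0|lra].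
  - exists (- m); repeat split; [exact Hm|lra|].
    intros r Hr Hrs. enough (- r <= m) by lra.
    apply Hmax; [rewrite Ropp_involutive; exact Hr|lra].
Qed.

Section Chain.
Variables (n : nat) (s1 s2 : R) (a b : nat -> R) (C : (nat -> R) -> Prop).
Let between (x : nat -> R) : Prop := inS3 n s1 s2 x /\ below n b x /\ below n x a.
Hypotheses (Ia : inS3 n s1 s2 a) (Ib : inS3 n s1 s2 b) (Hba : below n b a).
Hypotheses (HC : forall x, C x -> between x)
  (Hchain : forall x y, C x -> C y -> below n x y \/ below n y x)
  (Hmax : forall w, between w -> (forall c, C c -> below n c w \/ below n w c) -> C w).

Lemma chain_below_of_cubes c d : C c -> C d -> cubes n c <= cubes n d -> below n c d.
Proof.
  intros Hc Hd Hle. destruct (Hchain c d Hc Hd) as [|H]; [assumption|].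
  apply (below_cubes_eq_below n s1 s2); [apply HC, Hd|apply HC, Hc|assumption|assumption].
Qed.

(** A limit l of chain members is comparable with each member c: if cubes n c differs from L, the
    approximants are eventually all on one side of c. Arguing by contradiction disposes of members
    with value L. Maximality then puts l in the chain. *)
Lemma chain_cubes_closed : limit_closed (fun r => exists c, C c /\ cubes n c = r).
Proof.
  intros L HL. apply NNPP; intros Hno.
  assert (Hc : forall k : nat, exists c, C c /\ Rabs (cubes n c - L) < / INR (S k)).
  { intros k. destruct (HL (/ INR (S k))) as (r & (c & Hc & <-) & Hr).
    - apply Rinv_0_lt_compat, lt_0_INR; lia.
    - eauto. }
  set (u := fun k => proj1_sig (constructive_indefinite_description _ (Hc k))).
  assert (Hu : forall k, C (u k) /\ Rabs (cubes n (u k) - L) < / INR (S k))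
    by (intros k; unfold u; apply proj2_sig).
  destruct (inS3_compact n s1 s2 u) as (sg & l & Hs & Hl & Il); [intros k; apply HC, Hu|].
  assert (HcL : Un_cv (fun k => cubes n (u (sg k))) L).
  { intros e He. destruct (inv_INR_lt e He) as [N HN]. exists N; intros k Hk.
    pose proof (extraction_ge sg k Hs). apply Rlt_trans with (/ INR (S (sg k))).
    - apply Hu.
    - apply HN; lia. }
  assert (HlL : cubes n l = L).
  { apply (UL_sequence (fun k => cubes n (u (sg k)))); [|exact HcL].
    apply (cubes_cv n (fun k => u (sg k))), Hl. }
  assert (Hlow : forall t, Un_cv (fun k => low n (u (sg k)) t) (low n l t))
    by (intros t; apply (low_cv n (fun k => u (sg k))), Hl).
  apply Hno. exists l; split; [|exact HlL]. apply Hmax.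
  - split; [exact Il|split; intros t].
    + apply (Un_cv_eventually_le _ _ _ _ 0 (Hlow t) (Un_cv_const _)).
      intros k _; apply HC, Hu.
    + apply (Un_cv_eventually_le _ _ _ _ 0 (Un_cv_const _) (Hlow t)).
      intros k _; apply HC, Hu.
  - intros c Hcc.
    destruct (Rtotal_order (cubes n c) L) as [Hlt|[Heq|Hgt]].
    + left; intros t.
      destruct (HcL (L - cubes n c) ltac:(lra)) as [N HN].
      apply (Un_cv_eventually_le _ _ _ _ N (Hlow t) (Un_cv_const _)).
      intros k Hk. specialize (HN k Hk). unfold Rdist in HN. apply Rabs_def2 in HN.
      apply chain_below_of_cubes; [exact Hcc|apply Hu|lra].
    + exfalso; apply Hno; eauto.
    + right; intros t.
      destruct (HcL (cubes n c - L) ltac:(lra)) as [N HN].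
      apply (Un_cv_eventually_le _ _ _ _ N (Un_cv_const _) (Hlow t)).
      intros k Hk. specialize (HN k Hk). unfold Rdist in HN. apply Rabs_def2 in HN.
      apply chain_below_of_cubes; [apply Hu|exact Hcc|lra].
Qed.

Lemma chain_bottom : C b.
Proof.
  apply Hmax; [repeat split; try apply Ib; [apply below_refl|exact Hba]|].
  intros c Hc; right; apply HC, Hc.
Qed.

Lemma chain_top : C a.
Proof.
  apply Hmax; [repeat split; try apply Ia; [exact Hba|apply below_refl]|].
  intros c Hc; left; apply HC, Hc.
Qed.

Lemma below_cubes_lt x y : inS3 n s1 s2 x -> inS3 n s1 s2 y ->
  below n x y -> ~ below n y x -> cubes n x < cubes n y.
Proof.
  intros Ix Iy Hb Hn. apply Rnot_le_lt; intros Hle.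
  apply Hn, (below_cubes_eq_below n s1 s2); assumption.
Qed.

Lemma chain_cubes_onto s : cubes n b <= s <= cubes n a -> exists c, C c /\ cubes n c = s.
Proof.
  intros Hs. apply NNPP; intros Hno.
  destruct (limit_closed_greatest _ s chain_cubes_closed) as (m & (l & Hl & <-) & Hls & Hlmax).
  { exists (cubes n b); split; [exists b; split; [apply chain_bottom|reflexivity]|lra]. }
  destruct (limit_closed_least _ s chain_cubes_closed) as (m & (u & Hu & <-) & Hus & Humin).
  { exists (cubes n a); split; [exists a; split; [apply chain_top|reflexivity]|lra]. }
  assert (cubes n l <> s) by (intros ?; apply Hno; eauto).
  assert (cubes n u <> s) by (intros ?; apply Hno; eauto).
  destruct (HC l Hl) as (Il & Hbl & _), (HC u Hu) as (Iu & _ & Hua).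
  assert (Hlu : below n l u) by (apply chain_below_of_cubes; auto; lra).
  destruct (below_dense n s1 s2 l u Il Iu Hlu) as (z & Iz & Hlz & Hzu & Nzl & Nuz).
  { intros Hul. pose proof (below_cubes_le n u l (inS3_same_moments _ _ _ _ _ Iu Il) Hul). lra. }
  pose proof (below_cubes_lt l z Il Iz Hlz Nzl). pose proof (below_cubes_lt z u Iz Iu Hzu Nuz).
  (* Members with value at most s lie below l, the others above u, so z is comparable with all of
     them. *)
  assert (Hz : C z).
  { apply Hmax.
    - split; [exact Iz|split; eapply below_trans; eassumption].
    - intros c Hc. destruct (Rle_lt_dec (cubes n c) s) as [Hcs|Hcs].
      + left. apply below_trans with l; [|exact Hlz].
        apply chain_below_of_cubes; auto. apply Hlmax; eauto.
      + right. apply below_trans with u; [exact Hzu|].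
        apply chain_below_of_cubes; auto. apply Humin; eauto; lra. }
  destruct (Rle_lt_dec (cubes n z) s) as [Hzs|Hzs].
  - specialize (Hlmax (cubes n z) ltac:(eauto) Hzs). lra.
  - specialize (Humin (cubes n z) ltac:(eauto) ltac:(lra)). lra.
Qed.
End Chain.

(** * Construction of the path *)

Theorem mainTheorem18 (n : nat) (s1 s2 : R) (a b : nat -> R) :
  (3 <= n)%nat ->
  inS3 n s1 s2 a -> inS3 n s1 s2 b -> maj3 n a b ->
  exists p : R -> nat -> R,
    (forall t, unit_interval t -> inS3 n s1 s2 (p t)) /\
    (forall i, (i < n)%nat -> forall t, unit_interval t ->
        limit1_in (fun s => p s i) unit_interval (p t i) t) /\
    (forall i, (i < n)%nat -> p 0 i = b i) /\
    (forall i, (i < n)%nat -> p 1 i = a i) /\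
    (forall t0 t1, unit_interval t0 -> unit_interval t1 -> t0 <= t1 ->
        maj3 n (p t1) (p t0)).
Proof.
  intros _ Ia Ib Hab. apply maj3_below in Hab.
  destruct (maximal_chain _ (below n) (fun x => inS3 n s1 s2 x /\ below n b x /\ below n x a)
    (below_refl n)) as (C & HC & Hchain & Hmax).
  pose proof (below_cubes_le n b a (inS3_same_moments _ _ _ _ _ Ib Ia) Hab) as Hcba.
  set (D := cubes n a - cubes n b). assert (HD : 0 <= D) by (unfold D; lra).
  assert (Hex : forall t, exists c, unit_interval t -> C c /\ cubes n c = cubes n b + t * D).
  { intros t. destruct (classic (unit_interval t)) as [Ht|Ht]; [|exists a; tauto].
    destruct (chain_cubes_onto n s1 s2 a b C Ia Ib Hab HC Hchain Hmax (cubes n b + t * D)) as (c & Hc).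
    - destruct Ht. unfold D in *. nra.
    - exists c; intros _; exact Hc. }
  set (p := fun t => proj1_sig (constructive_indefinite_description _ (Hex t))).
  assert (Hp : forall t, unit_interval t -> C (p t) /\ cubes n (p t) = cubes n b + t * D)
    by (intros t; unfold p; apply proj2_sig).
  assert (H0 : unit_interval 0) by (unfold unit_interval; lra).
  assert (H1 : unit_interval 1) by (unfold unit_interval; lra).
  assert (HpI : forall t, unit_interval t -> inS3 n s1 s2 (p t)) by (intros t Ht; apply HC, Hp, Ht).
  exists p; split; [exact HpI|split; [|split; [|split]]].
  - intros i Hi t Ht e He.
    destruct (cubes_modulus n s1 s2 i e Hi He) as (d & Hd & Hmod).
    (* D + 1 instead of D covers the case D = 0. *)
    exists (d / (D + 1)); split; [apply Rdiv_lt_0_compat; lra|].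
    intros s [Hs Hst]. simpl in *. unfold Rdist in *.
    destruct (Hp s Hs) as [Cs Es], (Hp t Ht) as [Ct Et].
    assert (Hq : d / (D + 1) * (D + 1) = d) by (field; lra).
    apply Rabs_def2 in Hst.
    destruct (Hchain (p s) (p t) Cs Ct) as [H|H].
    + apply Hmod; auto. rewrite Es, Et. nra.
    + rewrite Rabs_minus_sym. apply Hmod; auto. rewrite Es, Et. nra.
  (* The chosen member has the cubes of [b], so it agrees with [b] on the first n coordinates;
     beyond them it may differ. *)
  - intros i Hi. symmetry. destruct (Hp 0 H0) as [C0 E0].
    apply (below_cubes_eq_coord n s1 s2); auto; [apply HC, C0|lra].
  - intros i Hi. destruct (Hp 1 H1) as [C1 E1].
    apply (below_cubes_eq_coord n s1 s2); auto; [apply HC, C1|unfold D in E1; lra].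
  - intros t0 t1 Ht0 Ht1 Hle. destruct (Hp t0 Ht0) as [C0 E0], (Hp t1 Ht1) as [C1 E1].
    apply below_maj3; [apply (inS3_same_moments n s1 s2); auto|].
    apply (chain_below_of_cubes n s1 s2 a b C HC Hchain); auto. nra.
Qed.
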